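(* Let $M$ be a locally-finite map in the hyperbolic plane with exactly one end such that $V(M)$ is a locally finite collection of vertices, and suppose $G\le\mathrm{Isom}(\mathbb{H}^2)$ acts quasi-transitively on $M$. Then there exist a positive integer $m$, a proper vertex colouring $\mathcal{C}:V(M)\to\{1,\dots,m\}$ and a finite index subgroup $T\le G$ such that $\mathcal{C}$ is $T$-invariant, i.e. $\mathcal{C}(tx)=\mathcal{C}(x)$ for all $t\in T$, $x\in V(M)$.
   Context: A map $M$ in a surface $X$ is a (simple, connected, infinite) graph embedded in $X$: vertices are distinct points, edges are curves meeting only at common endpoints, and each face is homeomorphic to an open disc. Locally-finite and number of ends refer to the underlying graph. $V(M)$ is a locally finite collection of vertices if every compact subset contains only finitely many vertices of $M$. $G$ acts on $M$ if each $g\in G$ maps $M$ to itself with $g(V(M))=V(M)$ inducing a graph automorphism; quasi-transitively means finitely many orbits on $V(M)$. A proper vertex colouring gives adjacent vertices distinct colours. *)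

(* Defs.v *)
From HB Require Import structures.
From mathcomp Require Import all_boot all_order all_algebra.
From mathcomp Require Import all_classical all_reals all_analysis.
From mathcomp Require Import Rstruct Rstruct_topology.
From Stdlib Require Import Relations.
Set Implicit Arguments. Unset Strict Implicit. Unset Printing Implicit Defensive.
Import Order.TTheory GRing.Theory Num.Theory.
Local Open Scope classical_set_scope.
Local Open Scope ring_scope.

(** Ambient plane R^2; the hyperbolic plane is the Poincare disc model. *)
Definition RR := Rdefinitions.R.
Definition P := (RR * RR)%type.

Definition nsq (p : P) : RR := p.1 ^+ 2 + p.2 ^+ 2.

(** The open unit disc: carrier of H^2 (Poincare model); its Euclidean
    subspace topology is the topology of H^2. *)
Definition Disc : set P := [set p | nsq p < 1].

(** Hyperbolic distance in the Poincare disc: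
    d(p,q) = arcosh (1 + 2|p-q|^2 / ((1-|p|^2)(1-|q|^2))),
    with arcosh y = ln (y + sqrt (y^2 - 1)). *)
Definition hdist (p q : P) : RR :=
  let y := 1 + 2 * (((p.1 - q.1) ^+ 2 + (p.2 - q.2) ^+ 2)
                    / ((1 - nsq p) * (1 - nsq q))) in
  ln (y + Num.sqrt (y ^+ 2 - 1)).

(** Isometries of H^2, represented as maps of the plane which are the
    identity outside the disc (canonical extension, so that equality of
    isometries is equality of functions). *)
Definition isometry (g : P -> P) : Prop :=
  [/\ (forall p, ~ Disc p -> g p = p),
      g @` Disc = Disc &
      forall p q, Disc p -> Disc q -> hdist (g p) (g q) = hdist p q].

Definition is_group (G : set (P -> P)) : Prop :=
  [/\ G id,
      (forall g h, G g -> G h -> G (g \o h)) &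
      (forall g, G g -> exists2 h, G h & (h \o g = id /\ g \o h = id))].

Definition isom_subgroup (G : set (P -> P)) : Prop :=
  is_group G /\ G `<=` isometry.

Definition finite_index_subgroup (G T : set (P -> P)) : Prop :=
  [/\ is_group T, T `<=` G &
      exists s : seq (P -> P), (forall r, r \in s -> G r) /\
        forall g, G g -> exists2 r, r \in s & exists2 t, T t & g = r \o t].

(** A (candidate) map: vertex set and edges given by parametrised curves
    on [0,1], indexed by a type of edges. *)
Record graph_drawing := Drawing {
  dV : set P;
  dE : Type;
  dcurve : dE -> RR -> P }.

Section Drawing.
Variable M : graph_drawing.
Local Notation V := (dV M).
Local Notation curve := (@dcurve M).

Definition unit_int : set RR := `[0, 1]%classic.
Definition open_unit_int : set RR := `]0, 1[%classic.

Definition mset : set P := V `|` \bigcup_(e in [set: dE M]) (curve e @` unit_int).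

Definition adj (u v : P) : Prop :=
  exists e, (curve e 0 = u /\ curve e 1 = v) \/ (curve e 0 = v /\ curve e 1 = u).

Definition reach (W : set P) : P -> P -> Prop :=
  clos_refl_trans P (fun u v => W u /\ W v /\ adj u v).

Definition comp (W : set P) (u : P) : set P := [set v | W v /\ reach W u v].

Definition homeomorphic (A B : set P) : Prop :=
  exists f g : P -> P,
    [/\ f @` A `<=` B /\ g @` B `<=` A,
        (forall x, A x -> g (f x) = x),
        (forall y, B y -> f (g y) = y),
        {within A, continuous f} & {within B, continuous g}].

Definition is_map_H2 : Prop :=
  V `<=` Disc /\
  [/\
      (forall e, [/\ {within unit_int, continuous (curve e)},
                    {in unit_int &, injective (curve e)},
                    curve e @` unit_int `<=` Disc,
                    V (curve e 0) /\ V (curve e 1) &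
                    curve e @` open_unit_int `&` V = set0]),
      (forall e e', e <> e' ->
         curve e @` unit_int `&` curve e' @` unit_int `<=` V),
      (* simple graph: no multiple edges (no loops by injectivity) *)
      (forall e e', e <> e' ->
         [set curve e 0; curve e 1] <> [set curve e' 0; curve e' 1]),
      (forall u v, V u -> V v -> reach V u v) /\ ~ finite_set V &
      (forall x, Disc x -> ~ mset x ->
         homeomorphic Disc (connected_component (Disc `\` mset) x))].

Definition locally_finite_graph : Prop :=
  forall v, V v -> finite_set [set e | curve e 0 = v \/ curve e 1 = v].

Definition one_ended : Prop :=
  (forall S : set P, finite_set S ->
     forall u v, (V `\` S) u -> (V `\` S) v ->
       infinite_set (comp (V `\` S) u) -> infinite_set (comp (V `\` S) v) ->
       reach (V `\` S) u v) /\
  (exists2 S : set P, finite_set S &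
     exists2 u, (V `\` S) u & infinite_set (comp (V `\` S) u)).

Definition locally_finite_vertices : Prop :=
  forall K : set P, compact K -> K `<=` Disc -> finite_set (K `&` V).

Definition acts_on (G : set (P -> P)) : Prop :=
  forall g, G g ->
    [/\ g @` V = V, g @` mset = mset &
        forall u v, V u -> V v -> (adj u v <-> adj (g u) (g v))].

Definition quasi_transitive (G : set (P -> P)) : Prop :=
  exists s : seq P, forall v, V v ->
    exists2 x, x \in s & exists2 g, G g & v = g x.

End Drawing.

(* Main.v *)
Require Import Defs.
From mathcomp Require Import all_boot all_order all_algebra all_field.
From mathcomp Require Import all_classical all_reals all_analysis.
From mathcomp Require Import Rstruct Rstruct_topology ring lra.
From Stdlib Require Import Relations.
Set Implicit Arguments. Unset Strict Implicit. Unset Printing Implicit Defensive.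
Import Order.TTheory GRing.Theory Num.Theory numFieldNormedType.Exports.
Local Open Scope classical_set_scope.
Local Open Scope ring_scope.

(** In the hyperboloid model the isometries of H^2 act linearly, so G acts on
    the vertices through a linear group over the reals. Only finitely many
    linear maps arise from elements moving an orbit representative to (a
    neighbour of) an orbit representative, because V(M) is locally finite, and
    they generate the group because M is connected. By Malcev's argument, a
    finitely generated subring of a field has homomorphisms to finite fields
    that do not vanish at a given nonzero element, so some homomorphism from G
    to a finite matrix group is nontrivial on all these elements that act
    nontrivially. Its kernel T has finite index, and being normal it moves no
    vertex to a neighbour; the colouring by T-orbits is then proper. *)

(** * Finitely generated rings and finite fields *)

Lemma finField_adjoin_root (F : finFieldType) (p : {poly F}) : (1 < size p)%N ->
  exists (F' : finFieldType) (i : {rmorphism F -> F'}) (x : F'),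
    root (map_poly i p) x.
Proof.
move=> p_gt1.
have p0 : p != 0 by rewrite -size_poly_gt0 ltnW.
have [L [rs eq_rs _]] := FinSplittingFieldFor p0.
exists (FinFieldExtType L), (in_alg L).
case: rs eq_rs => [|x rs] eq_rs.
  move: (eqp_size eq_rs); rewrite big_nil size_map_poly size_poly1 => sp.
  by rewrite sp in p_gt1.
by exists x; rewrite (eqp_root eq_rs) big_cons rootM root_XsubC eqxx.
Qed.

(* The kernel condition says that [f] factors through the subring [e R] of [K];
   working with the pair [(R, e)] avoids constructing that subring as a type. *)
Definition finField_separated (K : fieldType) (R : comNzRingType)
    (e : {rmorphism R -> K}) : Prop :=
  forall c, e c != 0 -> exists (F : finFieldType) (f : {rmorphism R -> F}),
    (forall r, e r = 0 -> f r = 0) /\ f c != 0.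

Section Adjoin.
Variables (K : fieldType) (R : comNzRingType) (e : {rmorphism R -> K}) (b : K).

(** Its image is the subring generated by [e R] and [b], so adjoining [b] replaces the pair [(R, e)]
    by [({poly R}, adjoin_eval)]. *)
Definition adjoin_eval : {rmorphism {poly R} -> K} := horner_eval b \o map_poly e.
Local Notation ev := adjoin_eval.

Lemma adjoin_evalE p : ev p = (map_poly e p).[b].
Proof. by []. Qed.

Lemma adjoin_evalC c : ev c%:P = e c.
Proof. by rewrite adjoin_evalE map_polyC hornerC. Qed.

Lemma adjoin_evalX : ev 'X = b.
Proof. by rewrite adjoin_evalE map_polyX hornerX. Qed.

(** As [e] may kill leading coefficients, [p] can be longer than its image. Since [Q] depends only
    on the image, truncating a [p] with shortest image to the size of that image restores a
    surviving leading coefficient. *)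
Lemma min_size_rep (Q : {poly R} -> Prop) :
    (forall p q, map_poly e p = map_poly e q -> Q p -> Q q) ->
    (exists p, Q p) ->
    (forall p, Q p -> map_poly e p != 0) ->
  exists p, [/\ Q p, e (lead_coef p) != 0 &
    forall q, Q q -> (size p <= size (map_poly e q))%N].
Proof.
move=> Qe exQ Qn0.
have exn : exists n, `[< exists2 p, Q p & size (map_poly e p) = n >].
  by case: exQ => p Qp; exists (size (map_poly e p)); apply/asboolP; exists p.
case: (ex_minnP exn) => n /asboolP[p Qp szp] minn.
have eq_p : map_poly e p = map_poly e (take_poly n p).
  apply/polyP => i; rewrite !coef_map coef_take_poly.
  case: ltnP => // le_ni; rewrite [RHS]raddf0 -coef_map nth_default ?szp //.
have Qt := Qe _ _ eq_p Qp.
have sz_t : size (take_poly n p) = n.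
  by apply/eqP; rewrite eqn_leq size_take_poly -{1}szp eq_p size_poly.
exists (take_poly n p); split=> //.
  rewrite /lead_coef sz_t -coef_map -eq_p -szp -/(lead_coef _) lead_coef_eq0.
  exact: Qn0.
by move=> q Qq; rewrite sz_t; apply: minn; apply/asboolP; exists q.
Qed.

Lemma adjoin_evalZ c p : ev (c *: p) = e c * ev p.
Proof. by rewrite !adjoin_evalE map_polyZ hornerZ. Qed.

End Adjoin.

Lemma map_poly_ker (R : comNzRingType) (K L : nzRingType)
    (e : {rmorphism R -> K}) (f : {rmorphism R -> L}) :
  (forall r, e r = 0 -> f r = 0) ->
  forall p, map_poly e p = 0 -> map_poly f p = 0.
Proof.
move=> kef p p0; apply/polyP => i; rewrite coef_map coef0; apply: kef.
by rewrite -(coef_map e) p0 coef0.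
Qed.

Lemma pseudo_division (R : comNzRingType) (p d : {poly R}) : d != 0 ->
  exists k q r, lead_coef d ^+ k *: p = q * d + r /\ (size r < size d)%N.
Proof.
move=> d0; exists (Pdiv.Ring.rscalp p d), (Pdiv.Ring.rdivp p d), (Pdiv.Ring.rmodp p d).
by rewrite Pdiv.Ring.ltn_rmodp d0; split=> //; exact: Pdiv.ComRing.rdivp_eq.
Qed.

(** Without relations on [b], its image can be chosen freely. Once [f] keeps the leading coefficient
    of the image of [c] nonzero, it remains to pick a non-root of [map_poly f c] in a finite
    extension. *)
Lemma finField_separated_transcendental (K : fieldType) (R : comNzRingType)
    (e : {rmorphism R -> K}) (b : K) :
  finField_separated e ->
  (forall p, adjoin_eval e b p = 0 -> map_poly e p = 0) ->
  finField_separated (adjoin_eval e b).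
Proof.
move=> sep_e trb c c0.
have mc0 : map_poly e c != 0.
  by apply: contraNneq c0 => mc; rewrite adjoin_evalE mc horner0.
have [F [f [kef fl]]] : exists (F : finFieldType) (f : {rmorphism R -> F}),
    (forall r, e r = 0 -> f r = 0) /\ f c`_(size (map_poly e c)).-1 != 0.
  by apply: sep_e; rewrite -coef_map -/(lead_coef _) lead_coef_eq0.
have q0 : map_poly f c != 0.
  by apply: contraNneq fl => q0; rewrite -coef_map q0 coef0.
(* A root of ['X * q + 1] in an extension field is not a root of [q]. *)
have szq : (1 < size ('X * map_poly f c + 1)%R)%N.
  rewrite size_polyDl mulrC size_mulX // ?size_poly1 ltnS ?size_poly_gt0 //.
have [F' [i [x rx]]] := finField_adjoin_root szq.
exists F', (adjoin_eval (i \o f) x); split=> [r /trb er0|].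
  by rewrite adjoin_evalE map_poly_comp (map_poly_ker kef er0) rmorph0 horner0.
apply: contraTneq rx => fc0; rewrite rootE rmorphD rmorphM /= map_polyX rmorph1.
rewrite hornerD hornerM hornerX hornerC -map_poly_comp.
by rewrite adjoin_evalE /= in fc0; rewrite fc0 mulr0 add0r oner_neq0.
Qed.

(** Modulo the kernel of evaluation, [c] has a nonzero constant multiple [a]. A map [f] that is
    nonzero on [a] and on the leading coefficient of a minimal relation [p0] extends by sending [b]
    to a root of the image of [p0]. *)
Lemma finField_separated_algebraic (K : fieldType) (R : comNzRingType)
    (e : {rmorphism R -> K}) (b : K) :
  finField_separated e ->
  (exists2 p, adjoin_eval e b p = 0 & map_poly e p != 0) ->
  finField_separated (adjoin_eval e b).
Proof.
move=> sep_e alg_b c c0; set ev := adjoin_eval e b in alg_b c0 *.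
have [p0 [[evp0 mp0] lp0 minp0]] : exists p, [/\ ev p = 0 /\ map_poly e p != 0,
    e (lead_coef p) != 0 & forall q, ev q = 0 /\ map_poly e q != 0 ->
      (size p <= size (map_poly e q))%N].
  apply: (min_size_rep (Q := fun p => ev p = 0 /\ map_poly e p != 0)).
  - by move=> p q; rewrite /ev !adjoin_evalE => ->.
  - by case: alg_b => p ? ?; exists p.
  - by move=> p [].
have p0n0 : p0 != 0 by apply: contraNneq lp0 => ->; rewrite lead_coef0 rmorph0.
have kerp0 r : ev r = 0 -> (size r < size p0)%N -> map_poly e r = 0.
  move=> evr szr; apply/eqP; apply: contraLR szr => mr; rewrite -leqNgt.
  exact: leq_trans (minp0 r (conj evr mr)) (size_poly _ _).
(* A multiple [g] of [c] modulo [ker ev], of minimal degree, is a constant: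
   otherwise the pseudo-division of [p0] by [g] contradicts the minimality of
   [g] (nonzero remainder) or of [p0] (zero remainder). *)
have [g [[evg [d evgd]] lg ming]] : exists g, [/\
    ev g != 0 /\ (exists d, ev g = ev d * ev c),
    e (lead_coef g) != 0 & forall q, ev q != 0 /\ (exists d, ev q = ev d * ev c) ->
      (size g <= size (map_poly e q))%N].
  apply: (min_size_rep (Q := fun g => ev g != 0 /\ exists d, ev g = ev d * ev c)).
  - by move=> p q; rewrite /ev !adjoin_evalE => ->.
  - by exists c; split=> //; exists 1; rewrite rmorph1 mul1r.
  - by move=> p [evp _]; apply: contraNneq evp => mp; rewrite /ev adjoin_evalE mp horner0.
have gn0 : g != 0 by apply: contraNneq lg => ->; rewrite lead_coef0 rmorph0.
(* The pseudo-remainder of [g] by [p0] is still a multiple of [c] with nonzero value, so [g] is no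
   longer than it. *)
have ltgp : (size g < size p0)%N.
  have [k [q [r [/(congr1 ev) Er ltr]]]] := pseudo_division g p0n0.
  rewrite /ev adjoin_evalZ rmorphD rmorphM -/ev evp0 mulr0 add0r rmorphXn in Er.
  apply: leq_ltn_trans ltr; apply: leq_trans (size_poly _ _); apply: ming; split.
    by rewrite -Er mulf_neq0 ?expf_neq0.
  exists ((lead_coef p0 ^+ k) *: d).
  by rewrite -Er evgd /ev adjoin_evalZ rmorphXn mulrA.
have g1 : (size g <= 1)%N.
  rewrite leqNgt; apply/negP => g_gt1.
  have [k [q [r [Er ltr]]]] := pseudo_division p0 gn0.
  have := congr1 ev Er.
  rewrite /ev adjoin_evalZ rmorphD rmorphM -/ev evp0 mulr0 => Eev.
  have evr : ev r = 0.
    apply/eqP; apply: contraLR ltr => evr; rewrite -leqNgt.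
    apply: leq_trans (size_poly _ _); apply: ming; split=> //.
    exists (- q * d); move/eqP: Eev; rewrite eq_sym addrC addr_eq0 => /eqP ->.
    by rewrite evgd rmorphM rmorphN mulrA !mulNr.
  have evq : ev q = 0.
    by move/eqP: Eev; rewrite evr addr0 eq_sym mulf_eq0 (negPf evg) orbF => /eqP.
  have mr : map_poly e r = 0 by apply: kerp0 => //; apply: ltn_trans ltgp.
  have := congr1 (map_poly e) Er.
  rewrite map_polyZ rmorphD rmorphM /= mr addr0 => EP.
  have lk0 : e (lead_coef g ^+ k) != 0 by rewrite rmorphXn expf_neq0.
  have mq : map_poly e q != 0.
    by apply: contraNneq mp0 => mq; rewrite mq mul0r in EP;
       move/eqP: EP; rewrite scaler_eq0 (negPf lk0).
  have szg : size (map_poly e g) = size g by rewrite size_map_poly_id0.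
  have mg : map_poly e g != 0 by rewrite -size_poly_gt0 szg ltnW.
  have := minp0 q (conj evq mq).
  have := congr1 (fun p : {poly K} => size p) EP.
  rewrite /= size_scale // size_mul // szg size_map_poly_id0 // => ->.
  have : (0 < size (map_poly e q))%N by rewrite size_poly_gt0.
  case: (size g) g_gt1 => [|[|n]] // _.
  by rewrite !addnS /= -addSn => _; rewrite leqNgt ltnS leq_addr.
have [a ga] : exists a, g = a%:P by exists g`_0; apply: size1_polyC.
have ea : e a != 0 by move: evg; rewrite /ev ga adjoin_evalC.
have la0 : e (lead_coef p0 * a) != 0 by rewrite rmorphM mulf_neq0.
have [F [f [kef fla]]] := sep_e _ la0.
move: fla; rewrite rmorphM mulf_eq0 negb_or => /andP[fl fa].
have p0_gt1 : (1 < size (map_poly f p0))%N.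
  rewrite size_map_poly_id0 // ltnNge; apply/negP => /size1_polyC p0C.
  move: evp0; rewrite p0C /ev adjoin_evalC => ep0; move/eqP: mp0; apply.
  by rewrite p0C map_polyC /= ep0 polyC0.
have [F' [i [x rx]]] := finField_adjoin_root p0_gt1.
pose fx := adjoin_eval (i \o f) x.
have fxp0 : fx p0 = 0.
  by move: rx; rewrite /fx adjoin_evalE map_poly_comp rootE => /eqP.
(* The pseudo-remainder of [r] by [p0] is a relation shorter than [p0], so its coefficients are
   killed by [e], hence by [f]. The power of the leading coefficient of [p0] then cancels by
   [fl]. *)
have kfx r : ev r = 0 -> fx r = 0.
  move=> evr; have [k [q [s [Er lts]]]] := pseudo_division r p0n0.
  have := congr1 ev Er.
  rewrite /ev adjoin_evalZ rmorphD rmorphM -/ev evp0 evr !mulr0 add0r => /esym evs.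
  have /(map_poly_ker kef) fs := kerp0 _ evs lts.
  have := congr1 fx Er.
  rewrite /fx adjoin_evalZ rmorphD rmorphM -/fx fxp0 mulr0 add0r.
  rewrite [fx s]adjoin_evalE map_poly_comp fs rmorph0 horner0 => /eqP.
  by rewrite mulf_eq0 /= rmorphXn fmorph_eq0 expf_eq0 (negPf fl) andbF => /eqP.
exists F', fx; split=> //.
have : fx (g - d * c) = 0.
  by apply: kfx; rewrite rmorphB rmorphM evgd subrr.
rewrite rmorphB rmorphM ga [fx a%:P]adjoin_evalC => /eqP.
rewrite subr_eq0; apply: contraTneq => ->.
by rewrite mulr0 /= fmorph_eq0.
Qed.

Theorem finField_separated_adjoin (K : fieldType) (R : comNzRingType)
    (e : {rmorphism R -> K}) (b : K) :
  finField_separated e -> finField_separated (adjoin_eval e b).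
Proof.
move=> sep_e; have [alg_b|trb] :=
  pselect (exists2 p, adjoin_eval e b p = 0 & map_poly e p != 0).
  exact: finField_separated_algebraic.
apply: finField_separated_transcendental => // p evp; apply: contra_notP trb.
by move=> /eqP mp; exists p.
Qed.

Lemma finField_separated_intr (K : numFieldType) :
  finField_separated (intr : {rmorphism int -> K}).
Proof.
move=> c; rewrite intr_eq0 => c0.
have [p lt_cp pr_p] := prime_above `|c|%N.
exists 'F_p, intr; split=> [r /eqP|]; first by rewrite intr_eq0 => /eqP ->.
apply/negP => /eqP cp0.
have : (`|c|%N%:R : 'F_p) == 0.
  by move/eqP: cp0; case: (c) => n //; rewrite NegzE rmorphN oppr_eq0.
rewrite -(dvdn_pcharf (pchar_Fp pr_p)) => /dvdn_leq; rewrite absz_gt0 => /(_ c0).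
by rewrite leqNgt lt_cp.
Qed.

Theorem finField_separated_seq (K : numFieldType) (s : seq K) :
  exists (R : comNzRingType) (e : {rmorphism R -> K}),
    finField_separated e /\ (forall x, x \in s -> exists r, e r = x).
Proof.
elim: s => [|b s [R [e [sep_e es]]]].
  by exists int, intr; split=> //; exact: finField_separated_intr.
exists {poly R}, (adjoin_eval e b); split; first exact: finField_separated_adjoin.
move=> x; rewrite inE => /predU1P[->|/es[r <-]]; first by exists 'X; rewrite adjoin_evalX.
by exists r%:P; rewrite adjoin_evalC.
Qed.

(** * Reduction of matrix monoids to finite fields *)

Inductive mx_monoid (R : pzSemiRingType) k (L : seq 'M[R]_k) : 'M[R]_k -> Prop :=
| MxMonoid1 : mx_monoid L 1%:M
| MxMonoidM A B : A \in L -> mx_monoid L B -> mx_monoid L (A *m B).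

(** Matrices of the monoid lift to [R], and applying [f] to a lift gives a result independent of the
    lift because [f] vanishes wherever [e] does; this makes [h] multiplicative on the monoid. *)
Theorem finField_representation (K : numFieldType) k (L : seq 'M[K]_k) :
  exists (F : finFieldType) (h : 'M[K]_k -> 'M[F]_k),
    [/\ h 1%:M = 1%:M,
      (forall A B, mx_monoid L A -> mx_monoid L B -> h (A *m B) = h A *m h B) &
      (forall A, A \in L -> A != 1%:M -> h A != 1%:M)].
Proof.
pose s := [seq (A : 'M[K]_k) ij.1 ij.2 | A <- L, ij <- enum {: 'I_k * 'I_k}].
have [R [e [sep_e es]]] := finField_separated_seq s.
have lift_L A : A \in L -> exists B, map_mx e B = A.
  move=> AL; have Aij i j : {r | e r = A i j}.
    apply: cid; apply: es; apply/allpairsP; exists (A, (i, j)).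
    by rewrite /= mem_enum.
  by exists (\matrix_(i, j) sval (Aij i j)); apply/matrixP => i j;
    rewrite !mxE; case: Aij.
have lift_mon A : mx_monoid L A -> exists B, map_mx e B = A.
  elim=> [|{}A B /lift_L[A' <-] _ [B' <-]]; first by exists 1%:M; rewrite map_mx1.
  by exists (A' *m B'); rewrite map_mxM.
have liftP A : {B | mx_monoid L A -> map_mx e B = A}.
  apply: cid; have [mA|mA] := pselect (mx_monoid L A); last by exists 0.
  by have [B eB] := lift_mon A mA; exists B.
pose lift A := sval (liftP A).
have liftK A : mx_monoid L A -> map_mx e (lift A) = A by rewrite /lift; case: (liftP A).
have monL A : A \in L -> mx_monoid L A.
  by move=> AL; rewrite -[A]mulmx1; apply: MxMonoidM => //; exact: MxMonoid1.
have monM A B : mx_monoid L A -> mx_monoid L B -> mx_monoid L (A *m B).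
  elim=> [|{}A A' AL _ IH] mB; first by rewrite mul1mx.
  by rewrite -mulmxA; apply: MxMonoidM => //; exact: IH.
(* Collects all nonzero entries of the [A - 1] into one product, so that a single [f] nonzero on [c]
   handles every matrix of [L]. *)
pose c := \prod_(A <- L) \prod_ij
  (if A ij.1 ij.2 == 1%:M ij.1 ij.2 then 1 else (lift A - 1%:M) ij.1 ij.2).
have c0 : e c != 0.
  rewrite rmorph_prod prodf_seq_neq0; apply/allP => A AL /=.
  rewrite rmorph_prod; apply/prodf_neq0 => ij _.
  case: (eqVneq (A ij.1 ij.2) _) => [_|Aij]; first by rewrite rmorph1 oner_neq0.
  have -> : e ((lift A - 1%:M) ij.1 ij.2) = A ij.1 ij.2 - 1%:M ij.1 ij.2.
    by rewrite -{2}(liftK A (monL A AL)) -(map_mx1 e) !mxE rmorphB.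
  by rewrite subr_eq0.
have [F [f [kef fc]]] := sep_e c c0.
have kerM (B B' : 'M[R]_k) : map_mx e B = map_mx e B' -> map_mx f B = map_mx f B'.
  move=> eB; apply/matrixP => i j; rewrite !mxE; apply/eqP; rewrite -subr_eq0 -rmorphB.
  apply/eqP/kef; rewrite rmorphB; apply/eqP; rewrite subr_eq0.
  by move/matrixP/(_ i j): eB; rewrite !mxE => ->.
exists F, (fun A => map_mx f (lift A)); split.
- rewrite -[RHS](map_mx1 f); apply: kerM; rewrite liftK ?map_mx1 //; exact: MxMonoid1.
- move=> A B mA mB; rewrite -map_mxM; apply: kerM.
  by rewrite map_mxM !liftK //; exact: monM.
- move=> A AL; apply: contraNneq => hA; apply/eqP/matrixP => i j.
  apply/eqP; apply: contraNT fc => Aij; rewrite rmorph_prod prodf_seq_eq0.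
  apply/hasP; exists A => //=; rewrite rmorph_prod (bigD1 (i, j)) //= (negPf Aij).
  rewrite mulf_eq0; apply/orP; left.
  by move/matrixP/(_ i j): hA; rewrite -(map_mx1 f) !mxE rmorphB => ->; rewrite subrr.
Qed.

(** * The hyperboloid model *)

(** The argument of arcosh in [hdist], that is, the hyperbolic cosine of the distance. *)
Definition hcosh (p q : P) : RR :=
  1 + 2 * (((p.1 - q.1) ^+ 2 + (p.2 - q.2) ^+ 2) / ((1 - nsq p) * (1 - nsq q))).

Lemma Disc_gt0 p : Disc p -> 0 < 1 - nsq p.
Proof. by rewrite subr_gt0. Qed.

Lemma hcosh_ge1 p q : Disc p -> Disc q -> 1 <= hcosh p q.
Proof.
move=> /Disc_gt0 p1 /Disc_gt0 q1; rewrite lerDl mulr_ge0 // divr_ge0 //.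
  by rewrite addr_ge0 ?sqr_ge0.
by rewrite ltW ?mulr_gt0.
Qed.

Lemma arcosh_inj (y z : RR) : 1 <= y -> 1 <= z ->
  ln (y + Num.sqrt (y ^+ 2 - 1)) = ln (z + Num.sqrt (z ^+ 2 - 1)) -> y = z.
Proof.
move=> y1 z1.
have pos (t : RR) : 1 <= t -> 0 < t + Num.sqrt (t ^+ 2 - 1).
  by move=> t1; rewrite ltr_wpDr ?sqrtr_ge0 // (lt_le_trans ltr01).
(* This relation recovers [t] from [s], as half of [s + 1 / s]. *)
have arg (t : RR) : 1 <= t -> let s := t + Num.sqrt (t ^+ 2 - 1) in
    s ^+ 2 + 1 = 2 * t * s.
  move=> t1 /=; have := @sqr_sqrtr _ (t ^+ 2 - 1).
  rewrite subr_ge0 exprn_ege1 // => /(_ isT); set r := Num.sqrt _ => Er; ring: Er.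
have := arg _ y1; have := arg _ z1 => /= Ez Ey.
move=> /ln_inj; rewrite !posrE !pos // => /(_ isT isT) Eyz.
move: Ey; rewrite Eyz Ez => /(mulIf _); rewrite gt_eqF ?pos // => /(_ isT).
by move=> /mulfI; rewrite pnatr_eq0 => /(_ isT).
Qed.

Lemma isometry_hcosh g p q : Defs.isometry g -> Disc p -> Disc q ->
  hcosh (g p) (g q) = hcosh p q.
Proof.
move=> [_ gD gd] Dp Dq.
have Dg r : Disc r -> Disc (g r) by move=> Dr; rewrite -gD; exists r.
by apply: arcosh_inj; rewrite ?hcosh_ge1 //; try exact: Dg; exact: gd.
Qed.

(* Inverse stereographic projection of the Poincare disc onto the hyperboloid
   [x0 ^ 2 - x1 ^ 2 - x2 ^ 2 = 1]. *)
Definition hyp (p : P) : 'rV[RR]_3 :=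
  \row_j ([:: 1 + nsq p; 2 * p.1; 2 * p.2]`_j / (1 - nsq p)).

Definition lorentz : 'M[RR]_3 := diag_mx (\row_j [:: 1; -1; -1]`_j).

Lemma lorentz_hyp p q : Disc p -> Disc q ->
  hyp p *m lorentz *m (hyp q)^T = (hcosh p q)%:M.
Proof.
move=> /Disc_gt0/lt0r_neq0 p1 /Disc_gt0/lt0r_neq0 q1.
apply/matrixP => i j; rewrite !ord1 !mxE !big_ord_recl big_ord0 mul_mx_diag !mxE /=.
rewrite /hcosh /nsq in p1 q1 *.
rewrite mulr1n; field; by rewrite p1 q1.
Qed.

Lemma hyp_inj p q : Disc p -> Disc q -> hyp p = hyp q -> p = q.
Proof.
move=> /Disc_gt0/lt0r_neq0 p1 /Disc_gt0/lt0r_neq0 q1 /matrixP pq.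
have p0 := pq 0 (inord 0); have {}pq1 := pq 0 (inord 1); have pq2 := pq 0 (inord 2).
move: p0 pq1 pq2; rewrite !mxE !inordK //= => E0 E1 E2.
(* Coordinate 0 alone determines the common denominator; the other two coordinates then give the
   point. *)
have Einv : (1 - nsq p)^-1 = (1 - nsq q)^-1.
  have inv n : 1 - n != 0 -> (1 - n)^-1 = ((1 + n) / (1 - n) + 1) / 2 :> RR.
    by move=> n1; field.
  by rewrite (inv _ p1) (inv _ q1) E0.
have q1i : (1 - nsq q)^-1 != 0 by rewrite invr_eq0.
have two : (2 : RR) != 0 by rewrite pnatr_eq0.
move: E1 E2; rewrite Einv => /(mulIf q1i)/(mulfI two) E1 /(mulIf q1i)/(mulfI two) E2.
by rewrite [p]surjective_pairing [q]surjective_pairing E1 E2.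
Qed.

Definition hyp_mx k (b : 'I_k -> P) : 'M[RR]_(k, 3) := \matrix_i hyp (b i).

Lemma row_hyp_mx k (b : 'I_k -> P) i : row i (hyp_mx b) = hyp (b i).
Proof. exact: rowK. Qed.

Lemma lorentz_unit : lorentz \in unitmx.
Proof.
rewrite unitmxE det_diag !big_ord_recl big_ord0 !mxE /= mulr1 mul1r mulrNN mulr1.
exact: unitr1.
Qed.

Lemma hyp_mx_unit : exists b : 'I_3 -> P,
  (forall i, Disc (b i)) /\ hyp_mx b \in unitmx.
Proof.
(* The origin and a point on each axis lift to a lower triangular matrix. *)
pose b (i : 'I_3) : P := nth (0, 0) [:: (0, 0); (2^-1, 0); (0, 2^-1)] i.
exists b; split.
  by by move=> [[|[|[|m]]] hi] //; rewrite /b /Disc /nsq /=; lra.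
rewrite unitmxE det_trig.
  rewrite !big_ord_recl big_ord0 /b !mxE /= /nsq /= unitfE; apply: lt0r_neq0.
  by rewrite !mulr_gt0 ?divr_gt0 ?invr_gt0 //; lra.
apply/is_trig_mxP => -[[|[|[|m]]] hi] [[|[|[|n]]] hj] // _;
  by rewrite !mxE /b /= ?mulr0 ?mul0r.
Qed.

(** The products of [hyp p] with the columns of [gram b] are the hyperbolic cosines of the distances
    from [p] to the [b i]. They are unchanged when [g] is applied throughout, and [gram (g \o b)] is
    invertible, so they determine [hyp (g p)] linearly. *)
Lemma isometry_linear g : Defs.isometry g ->
  exists A : 'M[RR]_3, forall p, Disc p -> hyp (g p) = hyp p *m A.
Proof.
move=> isog; have [b [Db Ub]] := hyp_mx_unit.
have Dg r : Disc r -> Disc (g r) by case: isog => _ gD _ Dr; rewrite -gD; exists r.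
pose gram c := lorentz *m (hyp_mx (k := 3) c)^T.
have gramE c p j : Disc p -> Disc (c j) -> (hyp p *m gram c) 0 j = hcosh p (c j).
  move=> Dp Dc; have := lorentz_hyp Dp Dc.
  move=> /matrixP/(_ 0 0); rewrite [RHS]mxE mulr1n => <-.
  rewrite -row_hyp_mx mulmxA !mxE; apply: eq_bigr => i _.
  by rewrite !mxE.
have gramg p : Disc p -> hyp (g p) *m gram (g \o b) = hyp p *m gram b.
  move=> Dp; apply/rowP => j; rewrite !gramE //=; try exact: Dg.
  exact: isometry_hcosh.
have Ug : gram (g \o b) \in unitmx.
  have : hyp_mx (g \o b) *m gram (g \o b) \in unitmx.
    have -> : hyp_mx (g \o b) *m gram (g \o b) = hyp_mx b *m gram b.
      apply/row_matrixP => i; rewrite 2!row_mul !row_hyp_mx; exact: gramg.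
    by rewrite /gram !unitmx_mul unitmx_tr Ub lorentz_unit.
  by rewrite unitmx_mul => /andP[].
exists (gram b *m invmx (gram (g \o b))) => p Dp.
by rewrite mulmxA -gramg // mulmxK.
Qed.

(** * Finiteness of the vertex set in hyperbolic balls *)

Lemma compact_disc (R : realType) (c : R) : c <= 1 ->
  compact [set p : R * R | p.1 ^+ 2 + p.2 ^+ 2 <= c].
Proof.
move=> c1; pose I : set R := `[-1, 1]%classic.
pose f (p : R * R) : R := p.1 ^+ 2 + p.2 ^+ 2.
have cf : continuous f.
  move=> p; apply: (cvgD (F := nbhs p) (f := fun q : R * R => q.1 ^+ 2)
    (g := fun q : R * R => q.2 ^+ 2)).
    by apply: (cvgM (F := nbhs p) (f := fst) (g := fst)); exact: cvg_fst.
  by apply: (cvgM (F := nbhs p) (f := snd) (g := snd)); exact: cvg_snd.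
apply: (@subclosed_compact _ _ (I `*` I)).
- have -> : [set p | p.1 ^+ 2 + p.2 ^+ 2 <= c] = f @^-1` [set x | x <= c] by [].
  by apply: closed_comp; [move=> p _; exact: cf | exact: closed_le].
- by apply: compact_setX; exact: segment_compact.
- move=> p /= pc; have := sqr_ge0 p.1; have := sqr_ge0 p.2.
  by move=> h1 h2; split; rewrite /I /= in_itv /=; apply/andP; split; nra.
Qed.

Lemma compact_nsq_le (c : RR) : c <= 1 -> compact [set p : P | nsq p <= c].
Proof. exact: (@compact_disc RR c). Qed.

(** Keeps hyperbolic balls away from the unit circle, inside a compact subset of the disc to which
    local finiteness of the vertices applies. *)
Lemma hcosh_ball w p r : Disc w -> Disc p -> hcosh w p <= r ->
  nsq p <= 1 - (1 - nsq w) / (4 * r).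
Proof.
move=> Dw Dp wpr; have r1 : 1 <= r := le_trans (hcosh_ge1 Dw Dp) wpr.
have w1 := Disc_gt0 Dw; have p1 := Disc_gt0 Dp.
have wp_gt0 : 0 < (1 - nsq w) * (1 - nsq p) by rewrite mulr_gt0.
have r0 : 0 < 4 * r by lra.
(* The right side equals [|w - p|^2 + (1 - w.p)^2 + det(w, p)^2], and [1 - w.p] is at least
   [(1 - |w|^2) / 2] because [|p| < 1]. *)
have num : (1 - nsq w) ^+ 2 / 4 <= hcosh w p * ((1 - nsq w) * (1 - nsq p)).
  rewrite /hcosh mulrDl mul1r -mulrA divfK ?gt_eqF //.
  move: w1 p1; rewrite /nsq; case: (w) (p) => [a b] [c d] /=; clear => w1 p1.
  have h : (1 - (a ^+ 2 + b ^+ 2)) / 2 <= 1 - (a * c + b * d).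
    have := sqr_ge0 (a - c); have := sqr_ge0 (b - d); nra.
  have := sqr_ge0 (a * d - b * c); have := sqr_ge0 (a - c); have := sqr_ge0 (b - d).
  nra.
rewrite lerBrDr -lerBrDl ler_pdivrMr //.
rewrite -(ler_pM2l w1) -expr2.
have : hcosh w p * ((1 - nsq w) * (1 - nsq p)) <= r * ((1 - nsq w) * (1 - nsq p)).
  by rewrite ler_pM2r.
lra.
Qed.

Lemma finite_hyperbolic_ball (M : graph_drawing) w r :
  locally_finite_vertices M -> dV M `<=` Disc -> Disc w ->
  finite_set [set p | dV M p /\ hcosh w p <= r].
Proof.
move=> lfM VD Dw.
have [r1|r1] := leP 1 r; last first.
  apply: (@sub_finite_set _ _ set0) => // p [/VD Dp wpr].
  by have := le_trans (hcosh_ge1 Dw Dp) wpr; rewrite leNgt r1.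
pose c := 1 - (1 - nsq w) / (4 * r).
have c1 : c < 1 by rewrite ltrBlDr ltrDl divr_gt0 ?Disc_gt0 //; lra.
apply: (sub_finite_set _ (lfM _ (compact_nsq_le (ltW c1)) _)).
  by move=> p [Vp wpr]; split=> //=; apply: hcosh_ball => //; exact: VD.
by move=> p /= pc; apply: le_lt_trans c1.
Qed.

(** * The action on the vertices *)

(** A free family of maximal length, which exists as the rank is at most 3. Taking the basis among
    vertices matters: their images are vertices, of which local finiteness leaves only finitely many
    to consider. *)
Lemma hyp_row_basis (V : set P) : exists k (b : 'I_k -> P),
  [/\ (forall i, V (b i)), row_free (hyp_mx b) &
      forall v, V v -> (hyp v <= hyp_mx b)%MS].
Proof.
pose Q k := `[< exists b : 'I_k -> P, (forall i, V (b i)) /\ row_free (hyp_mx b) >].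
have exQ : exists k, Q k.
  exists 0%N; apply/asboolP; exists (fun=> (0, 0)); split; first by case.
  by rewrite /row_free -leqn0 rank_leq_row.
have ubQ k : Q k -> (k <= 3)%N.
  by move=> /asboolP[b [_ /eqP <-]]; exact: rank_leq_col.
case: (ex_maxnP exQ ubQ) => k /asboolP[b [Vb fb]] maxk.
exists k, b; split=> // v Vv; apply: contraT => Nv.
pose b' (i : 'I_(1 + k)) := if fintype.split i is inr j then b j else v.
suff /maxk : Q (1 + k)%N by rewrite ltnn.
apply/asboolP; exists b'; split.
  by move=> i; rewrite /b'; case: splitP.
have -> : hyp_mx b' = col_mx (hyp v) (hyp_mx b).
  apply/matrixP => i j; rewrite [LHS]mxE [RHS]mxE /b'.
  by case: splitP => i' _; rewrite ?ord1 // [RHS]mxE.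
rewrite /row_free eqn_leq rank_leq_row /= -addsmxE add1n -{1}(eqP fb).
by apply: rank_ltmx; rewrite ltmxE addsmxSr addsmx_sub (negPf Nv).
Qed.

Section Representation.
Variables (V : set P) (k : nat) (b : 'I_k -> P).
Hypotheses (VD : V `<=` Disc) (Vb : forall i, V (b i)) (free_b : row_free (hyp_mx b)).
Hypothesis span_b : forall v, V v -> (hyp v <= hyp_mx b)%MS.

(* The action of [g] on the linear span of the lifted vertices. The vertices are
   not assumed to span the whole space, and the restriction makes an element
   acting trivially on [V] act trivially. As vectors are rows, it is an
   antimorphism. *)
Definition span_rep (g : P -> P) : 'M[RR]_k := hyp_mx (g \o b) *m pinvmx (hyp_mx b).

Definition stab_isometry (g : P -> P) := Defs.isometry g /\ g @` V = V.

Lemma stab_V g v : stab_isometry g -> V v -> V (g v).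
Proof. by case=> _ {2}<- Vv; exists v. Qed.

Lemma span_repK g : stab_isometry g -> span_rep g *m hyp_mx b = hyp_mx (g \o b).
Proof.
move=> sg; apply: mulmxKpV; apply/row_subP => i; rewrite row_hyp_mx.
exact/span_b/stab_V.
Qed.

(** The ambient linear map of [isometry_linear] agrees with [span_rep g] on the basis, hence on its
    span. *)
Lemma span_rep_hyp g c v : stab_isometry g -> V v ->
  hyp v = c *m hyp_mx b -> hyp (g v) = c *m span_rep g *m hyp_mx b.
Proof.
move=> sg Vv Ev; rewrite -mulmxA span_repK //.
have [A gA] := isometry_linear sg.1.
have -> : hyp_mx (g \o b) = hyp_mx b *m A.
  by apply/row_matrixP => i; rewrite row_mul !row_hyp_mx /= gA //; exact: VD.
by rewrite gA ?Ev ?mulmxA //; exact: VD.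
Qed.

Lemma span_rep_comp g h : stab_isometry g -> stab_isometry h ->
  stab_isometry (g \o h) -> span_rep (g \o h) = span_rep h *m span_rep g.
Proof.
move=> sg sh sgh; apply: (row_free_inj free_b); rewrite span_repK //.
apply/row_matrixP => i; rewrite row_hyp_mx 2!row_mul.
apply: (span_rep_hyp (v := h (b i))) => //; first exact: stab_V.
by rewrite -row_mul (span_repK sh) row_hyp_mx.
Qed.

Lemma span_rep_id : span_rep id = 1%:M.
Proof. exact: mulmxVp. Qed.

Lemma span_rep1 g v : stab_isometry g -> V v -> span_rep g = 1%:M -> g v = v.
Proof.
move=> sg Vv g1; have [c Ec] := submxP (span_b Vv).
apply: hyp_inj; [exact/VD/stab_V | exact: VD |].
by rewrite (span_rep_hyp sg Vv Ec) g1 mulmx1 -Ec.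
Qed.

End Representation.

Section Action.
Variables (M : graph_drawing) (G : set (P -> P)).
Hypotheses (VD : dV M `<=` Disc) (lfV : locally_finite_vertices M).
Hypothesis lfM : locally_finite_graph M.
Hypotheses (GG : is_group G) (Giso : G `<=` Defs.isometry) (actG : acts_on M G).
Hypothesis edgeV : forall e : dE M, dV M (dcurve e 0) /\ dV M (dcurve e 1).

Lemma finite_nbrs v : dV M v -> finite_set [set u | adj M v u].
Proof.
move=> Vv; pose E := [set e : dE M | dcurve e 0 = v \/ dcurve e 1 = v].
have fE : finite_set E := lfM Vv.
apply: (@sub_finite_set _ _ ((fun e => dcurve e 0) @` E `|` (fun e => dcurve e 1) @` E)).
  by move=> u [e [[e0 e1]|[e0 e1]]]; [right|left]; exists e => //; [left|right].
by rewrite finite_setU; split; exact: finite_image.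
Qed.

Lemma group_stab g : G g -> stab_isometry (dV M) g.
Proof. by move=> Gg; split; [exact: Giso | case: (actG Gg)]. Qed.

Lemma group_inv g : G g -> exists h, [/\ G h, cancel g h & cancel h g].
Proof.
case: GG => _ _ /[apply] -[h Gh [hg gh]]; exists h; split=> // x.
  by rewrite -[LHS]/((h \o g) x) hg.
by rewrite -[LHS]/((g \o h) x) gh.
Qed.

Variable s : seq P.
Hypothesis qtG : forall v, dV M v -> exists2 x, x \in s & exists2 g, G g & v = g x.

Lemma orbit_rep v : dV M v ->
  exists x g, [/\ x \in s, dV M x, G g & v = g x].
Proof.
move=> Vv; have [x xs [g Gg Ev]] := qtG Vv; exists x, g; split=> //.
have [h [Gh gh _]] := group_inv Gg.
by rewrite -(gh x) -Ev; apply: stab_V Vv; exact: group_stab.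
Qed.

(* As in the Schwarz-Milnor lemma, these elements generate [G]. *)
Definition short_move (g : P -> P) : Prop :=
  G g /\ exists x y, [/\ x \in s, dV M x, y \in s, dV M y & g y = x \/ adj M x (g y)].

Variables (k : nat) (b : 'I_k -> P).
Hypotheses (Vb : forall i, dV M (b i)) (free_b : row_free (hyp_mx b)).
Hypothesis span_b : forall v, dV M v -> (hyp v <= hyp_mx b)%MS.
Local Notation rho := (span_rep b).

(** A short move sends some representative [y] into the finite set [W], and [g (b i)] is as far from
    [g y] as [b i] is from [y]. So each [g (b i)] lies in a finite set, and these images determine
    the matrix. *)
Lemma finite_short_moves : exists L : seq 'M[RR]_k, forall g, short_move g -> rho g \in L.
Proof.
pose sV := [set x | x \in s] `&` dV M.
have fsV : finite_set sV by apply: finite_setIl; exact: finite_seq.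
pose W := \bigcup_(x in sV) ([set x] `|` [set u | adj M x u]).
have fW : finite_set W.
  apply: bigcup_finite => // x [_ Vx]; rewrite finite_setU.
  split; first exact: finite_set1.
  exact: finite_nbrs.
have WV : W `<=` dV M.
  by move=> w [x [_ Vx]] [->//|[e [[_ <-]|[<- _]]]]; case: (edgeV e).
pose Q := \bigcup_(i in [set: 'I_k]) \bigcup_(y in sV) \bigcup_(w in W)
  [set p | dV M p /\ hcosh w p <= hcosh y (b i)].
have /finite_seqP[q Eq] : finite_set Q.
  apply: bigcup_finite => [|i _]; first exact: finite_finset.
  apply: bigcup_finite => // y _; apply: bigcup_finite => // w Ww.
  by apply: finite_hyperbolic_ball => //; exact/VD/WV.
(* All families of [k] points of [q] are listed; the default [(0, 0)] is never reached, as the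
   indices are below [size q]. *)
exists [seq hyp_mx (fun i => nth (0, 0) q (f i)) *m pinvmx (hyp_mx b)
          | f : {ffun 'I_k -> 'I_(size q)} <- enum {: {ffun 'I_k -> 'I_(size q)}}].
move=> g [Gg [x [y [xs Vx ys Vy gy]]]].
have gq i : (index (g (b i)) q < size q)%N.
  rewrite index_mem; suff : Q (g (b i)) by rewrite Eq.
  exists i => //; exists y => //; exists (g y).
    by exists x.
  split; first by apply: stab_V => //; exact: group_stab.
  by rewrite isometry_hcosh //; [exact: Giso | exact: VD | exact: VD].
apply/mapP; exists [ffun i => Ordinal (gq i)]; first by rewrite mem_enum.
congr (_ *m _); apply/row_matrixP => i; rewrite !row_hyp_mx ffunE /=.
by rewrite nth_index // -index_mem.
Qed.

Lemma rho_comp g h : G g -> G h -> rho (g \o h) = rho h *m rho g.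
Proof.
move=> Gg Gh; apply: (span_rep_comp VD Vb free_b span_b); apply: group_stab => //.
by case: GG => _ mulG _; exact: mulG.
Qed.

Lemma rho_group_mon (L : seq 'M[RR]_k) :
    (forall u v, dV M u -> dV M v -> reach M (dV M) u v) ->
    dV M !=set0 ->
    (forall g, short_move g -> rho g \in L) ->
  forall g, G g -> mx_monoid L (rho g).
Proof.
move=> conM [v0 Vv0] LP g Gg.
have [x [_ [xs Vx _ _]]] := orbit_rep Vv0.
(* Induction along a path from [x]. As a vertex can be written [h y] in several ways, the claim
   covers all of them. *)
have step v : clos_refl_trans_n1 P (fun u v => dV M u /\ dV M v /\ adj M u v) x v ->
    forall h y, G h -> y \in s -> dV M y -> v = h y -> mx_monoid L (rho h).
  elim=> [h y Gh ys Vy xE|{}v w [Vv [Vw vw]] _ IH h y Gh ys Vy wE].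
    rewrite -[rho h]mulmx1; apply: MxMonoidM; last exact: MxMonoid1.
    by apply: LP; split=> //; exists x, y; split=> //; left.
  have [z [l [zs Vz Gl vE]]] := orbit_rep Vv.
  have [l' [Gl' ll' l'l]] := group_inv Gl.
  have Gl'h : G (l' \o h) by case: GG => _ mulG _; exact: mulG.
  (* Here [l'] carries the edge from [v] to [w] back to one at the representative [z], so [l' \o h]
     is a short move. The antimorphism puts its matrix on the left, as [MxMonoidM] requires. *)
  have -> : h = l \o (l' \o h) by apply/funext => p /=; rewrite l'l.
  rewrite rho_comp //; apply: MxMonoidM; last exact: (IH l z).
  apply: LP; split=> //; exists z, y; split=> //; right => /=.
  by have [_ _ /(_ _ _ Vv Vw)[/(_ vw)]] := actG Gl'; rewrite vE ll' wE.
apply: (step (g x) _ g x) => //; apply/clos_rt_rtn1/conM => //.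
by apply: stab_V => //; exact: group_stab.
Qed.

End Action.

(** * The finite-index kernel and the colouring by its orbits *)

Section Kernel.
Variables (G : set (P -> P)) (F : finFieldType) (k : nat) (h : (P -> P) -> 'M[F]_k).
Hypotheses (GG : is_group G) (h1 : h id = 1%:M).
Hypothesis hM : forall g g', G g -> G g' -> h (g \o g') = h g' *m h g.

Definition mx_kernel : set (P -> P) := [set g | G g /\ h g = 1%:M].

Lemma mx_kernel_group : is_group mx_kernel.
Proof.
case: GG => G1 Gmul Ginv; split; first by split.
  by move=> g g' [Gg g1] [Gg' g'1]; split; [exact: Gmul | rewrite (hM Gg Gg') g1 g'1 mulmx1].
move=> g [Gg g1]; have [g' Gg' [g'g gg']] := Ginv g Gg; exists g' => //; split=> //.
by rewrite -h1 -g'g (hM Gg' Gg) g1 mul1mx.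
Qed.

Lemma mx_kernel_conj g t : G g -> mx_kernel t ->
  exists g', [/\ G g', g' \o g = id, g \o g' = id & mx_kernel (g' \o (t \o g))].
Proof.
case: GG => G1 Gmul Ginv Gg [Gt t1]; have [g' Gg' [g'g gg']] := Ginv g Gg.
exists g'; split=> //; split; first by apply: (Gmul) => //; apply: Gmul.
rewrite (hM Gg' (Gmul _ _ Gt Gg)) (hM Gt Gg) t1 mulmx1.
by rewrite -(hM Gg' Gg) g'g.
Qed.

(** One representative is kept per matrix over the finite field. The factorisation [g' \o t] gives
    the finite index, and [t \o g'] the finiteness of the number of kernel orbits on vertices. *)
Lemma mx_kernel_cosets : exists r : seq (P -> P), (forall g, g \in r -> G g) /\
  forall g, G g -> exists2 g', g' \in r &
    (exists2 t, mx_kernel t & g = g' \o t) /\ (exists2 t, mx_kernel t & g = t \o g').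
Proof.
case: (GG) => G1 Gmul Ginv.
(* The identity stands in for matrices that are not the image of any element of [G]. *)
have repP A : {g | G g /\ forall g', G g' -> h g' = A -> h g = A}.
  apply: cid; have [[g Gg hg]|nA] := pselect (exists2 g, G g & h g = A).
    by exists g.
  by exists id; split=> // g' Gg' hg'; case: nA; exists g'.
exists [seq sval (repP A) | A <- enum {: 'M[F]_k}]; split.
  by move=> g /mapP[A _ ->]; case: (repP A) => ? [].
move=> g Gg; exists (sval (repP (h g))); first by apply: map_f; rewrite mem_enum.
case: (repP (h g)) => r [Gr /(_ g Gg erefl) hr] /=.
have [r' Gr' [r'r rr']] := Ginv r Gr.
split.
  exists (r' \o g); last by rewrite compA rr'.
  by split; [exact: Gmul | rewrite (hM Gr' Gg) -hr -(hM Gr' Gr) r'r].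
exists (g \o r'); last by rewrite -compA r'r.
by split; [exact: Gmul | rewrite (hM Gg Gr') -hr -(hM Gr Gr') rr'].
Qed.

Lemma mx_kernel_index : finite_index_subgroup G mx_kernel.
Proof.
split; [exact: mx_kernel_group | by move=> g [] |].
have [r [rG rP]] := mx_kernel_cosets; exists r; split=> // g /rP[g' g'r [gg' _]].
by exists g'.
Qed.

End Kernel.

Lemma orbit_colouring (T : set (P -> P)) (V : set P) (l : seq P) :
    is_group T -> (forall v, V v -> exists2 x, x \in l & exists2 t, T t & v = t x) ->
  exists C : P -> nat,
    [/\ (forall v, V v -> (1 <= C v <= size l)%N),
        (forall u v, V u -> V v -> C u = C v -> exists2 t, T t & v = t u) &
        (forall t x, T t -> C (t x) = C x)].
Proof.
move=> [T1 Tmul Tinv] lP.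
pose orb v x := `[< exists2 t, T t & v = t x >].
(* The colour is the position in [l] of the first point in the orbit of [v], shifted so that colours
   start at 1. *)
exists (fun v => (find (orb v) l).+1); split.
- move=> v /lP[x xl Ex] /=; rewrite -has_find; apply/hasP; exists x => //; exact/asboolP.
- have orbV v : V v -> exists2 t, T t & v = t (nth (0, 0) l (find (orb v) l)).
    move=> /lP[x xl Ex]; apply/asboolP/(@nth_find _ (0, 0) (orb v)).
    by apply/hasP; exists x => //; exact/asboolP.
  move=> u v /orbV[t Tt Eu] /orbV[t' Tt' Ev] [Euv].
  have [i Ti [it ti]] := Tinv t Tt; exists (t' \o i); first exact: Tmul.
  rewrite {1}Ev -Euv /= [in RHS]Eu; congr t'.
  by rewrite -[RHS]/((i \o t) _) it.
- move=> t x Tt; congr S; apply: eq_find => y; apply/asboolP/asboolP.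
    move=> [t' Tt' E]; have [i Ti [it _]] := Tinv t Tt.
    by exists (i \o t'); [exact: Tmul | rewrite /= -E -[RHS]/((i \o t) x) it].
  by move=> [t' Tt' ->]; exists (t \o t') => //; exact: Tmul.
Qed.

Theorem theorem4p4 (M : graph_drawing) (G : set (P -> P)) :
  is_map_H2 M -> locally_finite_graph M -> one_ended M ->
  locally_finite_vertices M ->
  isom_subgroup G -> acts_on M G -> quasi_transitive M G ->
  exists m : nat, (0 < m)%N /\
    exists C : P -> nat,
      [/\ (forall v, dV M v -> (1 <= C v <= m)%N),
          (forall u v, dV M u -> dV M v -> adj M u v -> C u <> C v) &
          exists T : set (P -> P),
            finite_index_subgroup G T /\
            (forall t x, T t -> dV M x -> C (t x) = C x)].
Proof.
move=> [VD [edges _ _ [conM infV] _]] lfM _ lfV [GG Giso] actG [s qtG].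
have edgeV (e : dE M) : dV M (dcurve e 0) /\ dV M (dcurve e 1) by case: (edges e).
have V0 : dV M !=set0 by apply/set0P; apply: contra_notN infV => /eqP ->.
have noloop v : ~ adj M v v.
  move=> [e E]; have [_ inj_e _ _ _] := edges e.
  have /eqP : (0 : RR) = 1; last by rewrite eq_sym oner_eq0.
  apply: inj_e; rewrite ?inE /unit_int /= ?in_itv /= ?lexx ?ler01 //.
  by case: E => -[-> ->].
have [k [b [Vb free_b span_b]]] := hyp_row_basis (dV M).
have stabG := group_stab Giso actG.
have [L LP] := finite_short_moves VD lfV lfM Giso actG edgeV s Vb.
have rho_mon := rho_group_mon VD GG Giso actG qtG Vb free_b span_b conM V0 LP.
have [F [h [h1 hM hL]]] := finField_representation L.
pose hr g := h (span_rep b g).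
have hr1 : hr id = 1%:M by rewrite /hr span_rep_id.
have hrM g g' : G g -> G g' -> hr (g \o g') = hr g' *m hr g.
  move=> Gg Gg'; rewrite /hr (rho_comp VD GG Giso actG Vb free_b span_b) //.
  by rewrite hM //; exact: rho_mon.
have [r [rG rP]] := mx_kernel_cosets GG hr1 hrM.
have TG := mx_kernel_group GG hr1 hrM.
pose l := [seq (g : P -> P) y | g <- r, y <- s].
have lP v : dV M v -> exists2 x, x \in l & exists2 t, mx_kernel G hr t & v = t x.
  move=> /qtG[y ys [g Gg ->]]; have [g' g'r [_ [t Tt ->]]] := rP g Gg.
  by exists (g' y); [apply/allpairsP; exists (g', y) | exists t].
have [C [Cl Corb CT]] := orbit_colouring TG lP.
exists (size l); split.
  by have [v /Cl/andP[C1 C2]] := V0; exact: leq_trans C2.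
exists C; split=> //; last first.
  exists (mx_kernel G hr); split; first exact: mx_kernel_index.
  by move=> t x Tt _; exact: CT.
(* If adjacent [u] and [v] share a colour, some [t] in the kernel sends [u] to [v]. Conjugated to a
   representative [y], it is a short move in the kernel, so its matrix is 1 by [hL]. It then fixes
   [y], which would be its own neighbour. *)
move=> u v Vu Vv uv Cuv; have [t Tt vE] := Corb u v Vu Vv Cuv.
have [y [g [ys Vy Gg uE]]] := orbit_rep GG Giso actG qtG Vu.
have [g' [Gg' g'g gg' [Gc hc]]] := mx_kernel_conj GG hr1 hrM Gg Tt.
have ycy : adj M y ((g' \o (t \o g)) y).
  have [_ _ /(_ _ _ Vu Vv)[/(_ uv)]] := actG g' Gg'.
  by rewrite vE uE -[g' (g y)]/((g' \o g) y) g'g.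
have cL : span_rep b (g' \o (t \o g)) \in L.
  by apply: LP; split=> //; exists y, y; split=> //; right.
have c1 : span_rep b (g' \o (t \o g)) = 1%:M.
  by apply/eqP; apply: contraT => /(hL _ cL); rewrite -/(hr _) hc eqxx.
by move: ycy; rewrite (span_rep1 VD Vb span_b (stabG _ Gc) Vy c1) => /noloop.
Qed.
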